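(* There exists a positive integer constant $k$ with the following property: for every finite group $G$ and every conjugacy class $\mathcal{C}$ of $G$, if every $k$ elements of $\mathcal{C}$ generate a solvable subgroup of $G$, then $\mathcal{C}$ generates a solvable subgroup of $G$.
   Context: ''Every $k$ elements of $\mathcal{C}$ generate a solvable subgroup'' means that for all $x_1,\dots,x_k\in\mathcal{C}$ (not necessarily distinct) the subgroup $\langle x_1,\dots,x_k\rangle$ is solvable. *)

(* Defs.v *)
From mathcomp Require Import all_boot all_fingroup all_solvable.

Set Implicit Arguments.
Unset Strict Implicit.
Unset Printing Implicit Defensive.

(* Main.v *)
Require Import Defs.
From mathcomp Require Import all_boot all_fingroup all_solvable.

Set Implicit Arguments.
Unset Strict Implicit.
Unset Printing Implicit Defensive.

(** We take k = 14.  Call the elements of the class C conjugates.  The key fact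
   is that a solvable group M generated by conjugates contains 7 of them which
   generate a subgroup of the same Fitting height as M.  Let h be the maximal
   Fitting height of the (solvable) subgroups generated by at most 14
   conjugates, and let M be generated by 7 conjugates and have height h.  The
   last nontrivial term K of the lower nilpotent series of M is nilpotent, and
   for every g the group <M, M^g> is generated by 14 conjugates, hence has
   height h, so that K and K^g lie together in a nilpotent subgroup.  By
   Baer-Suzuki K meets some O_q(G) nontrivially, and one passes to G / O_q(G).

   For the key fact, let M be minimal of its height h, let V be a minimal
   normal p-subgroup of M such that M / V has height h - 1, and let
   A = <y_1, ..., y_7> <= M be such that A / C_A(V) has height h - 1 (induction),
   the y_i being A-conjugates of some y.  If no group <y_1^w_1, ..., y_7^w_7> with all w_i in V is
   M, then the Hall p'-subgroup H of the last term of the lower nilpotent series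
   of A acts without fixed points on some irreducible W <= V, and a Hall
   conjugacy argument gives, for all w_i in W, one v in W such that every
   w_i v^-1 centralises y_i; therefore |W|^7 <= |W| |C_W(y)|^7.  This
   contradicts |C_W(y)|^6 <= |W|^5, which holds for every solvable group
   A = <y^A> acting irreducibly and nontrivially on W. *)

Local Open Scope group_scope.

(** * Iterated nilpotent residuals *)

Section Residual.

(* For groups G of order at most n, 'L_n.+1(G) is the nilpotent residual of G,
   and nilres n h G = 1 means that G has Fitting height at most h. Fixing n once
   makes nilres monotone and compatible with quotients. *)
Definition nilres n h (gT : finGroupType) (G : {group gT}) : {group gT} :=
  iter h (fun H : {group gT} => 'L_n.+1(H)%G) G.

Variable n : nat.
Implicit Type gT : finGroupType.

Lemma nilresS h gT (G : {group gT}) : nilres n h.+1 G = 'L_n.+1(nilres n h G)%G.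
Proof. by []. Qed.

Lemma nilres_char h gT (G : {group gT}) : nilres n h G \char G.
Proof.
elim: h => [|h IHh]; first exact: char_refl.
exact: char_trans (lcn_char _ _) IHh.
Qed.

Lemma nilres_sub h gT (G : {group gT}) : nilres n h G \subset G.
Proof. exact/char_sub/nilres_char. Qed.

Lemma nilres_mono h gT (H G : {group gT}) :
  H \subset G -> nilres n h H \subset nilres n h G.
Proof. by move=> sHG; elim: h => //= h; apply: lcnS. Qed.

Lemma nilresJ h gT (G : {group gT}) x : nilres n h (G :^ x)%G :=: nilres n h G :^ x.
Proof.
elim: h => //= h; move: (nilres n h _) (nilres n h _) => H K /= ->.
by elim: n => [|m]; rewrite ?lcn1 //= !lcnSn conjsRg => ->.
Qed.

Lemma quotient_nilres h gT (G K : {group gT}) :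
  G \subset 'N(K) -> nilres n h (G / K)%G :=: nilres n h G / K.
Proof.
move=> nKG; elim: h => //= h /= ->.
apply/esym/(morphim_lcn (coset_morphism K)).
exact: subset_trans (nilres_sub _ _) nKG.
Qed.

Lemma lcn_card_nil gT (G : {group gT}) :
  #|G| <= n -> nilpotent G -> 'L_n.+1(G) = 1.
Proof.
move=> leGn nilG; apply/lcn_nil_classP => //; apply: leq_trans leGn.
by move: nilG; rewrite nilpotent_class => /ltnW.
Qed.

Lemma nilpotent_nilres h gT (G : {group gT}) :
  nilres n h.+1 G :=: 1 -> nilpotent (nilres n h G).
Proof. by move=> eq1; apply/lcnP; exists n. Qed.

(** Modulo [K] the images of [A] and [B] are normal and nilpotent, hence lie in the Fitting
    subgroup, and so does their join. *)
Lemma lcn_joing gT (G A B : {group gT}) :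
    A <| G -> B <| G -> #|G| <= n ->
  'L_n.+1(A <*> B) \subset 'L_n.+1(A) <*> 'L_n.+1(B).
Proof.
move=> nsAG nsBG leGn; set K := 'L_n.+1(A) <*> 'L_n.+1(B).
have nsKG: K <| G by rewrite normalY // (char_normal_trans (lcn_char _ _)).
have [sAG sBG] := (normal_sub nsAG, normal_sub nsBG).
have nKG := normal_norm nsKG.
have sABG: A <*> B \subset G by rewrite join_subG sAG.
have nilq (C : {group gT}): C <| G -> 'L_n.+1(C) \subset K ->
   C / K <| G / K /\ nilpotent (C / K).
  move=> nsCG sLK; split; first exact: quotient_normal.
  have sCG := normal_sub nsCG.
  apply/lcnP; exists n.
  rewrite -(morphim_lcn (coset_morphism K)) ?(subset_trans sCG) //.
  exact: quotientS1.
have [nsA nilA] := nilq A nsAG (joing_subl _ _).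
have [nsB nilB] := nilq B nsBG (joing_subr _ _).
have nilAB: nilpotent ((A <*> B) / K).
  rewrite quotientY ?(subset_trans sAG) ?(subset_trans sBG) //.
  have sFA := Fitting_max nsA nilA; have sFB := Fitting_max nsB nilB.
  by apply: nilpotentS (Fitting_nil (G / K)); rewrite join_subG sFA.
have nKAB := subset_trans sABG nKG.
rewrite -quotient_sub1 ?(subset_trans (lcn_sub _ _)) //.
have -> : 'L_n.+1(A <*> B) / K = 'L_n.+1(A <*> B / K).
  exact: (morphim_lcn (coset_morphism K)).
rewrite (@lcn_card_nil _ (A <*> B / K)%G) //.
exact: leq_trans (leq_morphim _ _) (leq_trans (subset_leq_card sABG) leGn).
Qed.

Lemma nilres_joing h gT (G A B : {group gT}) :
    A <| G -> B <| G -> #|G| <= n ->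
  nilres n h (A <*> B)%G \subset nilres n h A <*> nilres n h B.
Proof.
move=> nsAG nsBG leGn; elim: h => //= h IHh.
apply: subset_trans (lcnS n.+1 IHh) (lcn_joing _ _ leGn);
by rewrite (char_normal_trans (nilres_char _ _)).
Qed.

(** A maximal normal subgroup with residual in [K] absorbs every [<<s ^: G>>]. In contrapositive
    form: a residual of [G] that escapes [K] already does so for the normal closure of one
    generator. *)
Lemma nilres_class_gen h gT (G K : {group gT}) (S : {set gT}) :
    <<S>> = G -> #|G| <= n ->
    (forall s, s \in S -> nilres n h <<s ^: G>>%G \subset K) ->
  nilres n h G \subset K.
Proof.
move=> defG leGn sSK.
pose P (H : {group gT}) := (H <| G) && (nilres n h H \subset K).
have [|H /maxgroupP[/andP[nsHG sHK] maxH] _] := @maxgroup_exists _ P 1%G.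
  by rewrite /P normal1 (subset_trans (nilres_sub _ _)) ?sub1G.
suffices /group_inj <-: H :=: G by [].
apply/eqP; rewrite eqEsubset normal_sub //= -defG gen_subG.
apply/subsetP=> s Ss.
have Gs: s \in G by rewrite -defG mem_gen.
have nsC: <<s ^: G>> <| G.
  by rewrite /normal gen_subG class_subG ?norms_gen ?class_norm.
rewrite -(maxH (H <*> <<s ^: G>>)%G) ?joing_subl //.
  by rewrite (subsetP (joing_subr _ _)) ?mem_gen ?class_refl.
rewrite /P normalY //=.
apply: subset_trans (nilres_joing h nsHG nsC leGn) _.
by rewrite join_subG sHK; apply: sSK.
Qed.

Lemma solvable_nilres1 h gT (G : {group gT}) :
  0 < n -> solvable G -> #|G| <= h -> nilres n h G :=: 1.
Proof.
move=> n_gt0 solG leGh.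
(* The residual lies in the derived subgroup, so each step from a nontrivial solvable group lowers
   the order. *)
suffices: nilres n h G :=: 1 \/ #|nilres n h G| + h <= #|G|.
  case=> // /leq_trans/(_ leGh); rewrite -{3}[h]add0n leq_add2r leqn0 => /eqP c0.
  by have:= cardG_gt0 (nilres n h G); rewrite c0.
elim: h {leGh} => [|h IHh]; first by right; rewrite addn0.
have [ntH|] := eqVneq (nilres n h G) 1%G.
  by left; rewrite nilresS ntH; apply/trivgP/lcn_sub.
case: IHh => [/(@group_inj _ _ 1%G)->|leh ntH]; first by rewrite eqxx.
right; rewrite addnS; apply: leq_trans leh; rewrite -addSn leq_add2r.
apply: proper_card; apply: sub_proper_trans (sol_der1_proper solG _ ntH).
  by rewrite nilresS -lcn2 lcn_sub_leq.
exact: nilres_sub.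
Qed.

End Residual.

(** * Fixed points in irreducible solvable actions *)

Lemma class_gen_subset (gT : finGroupType) (A H : {group gT}) y :
  <<y ^: A>> = A -> A \subset 'N(H) -> y \in H -> A \subset H.
Proof. by move=> defA nHA Hy; rewrite -defA gen_subG class_sub_norm. Qed.

Lemma quotient_class_gen (gT : finGroupType) (A K : {group gT}) y :
    <<y ^: A>> = A -> y \in A -> A \subset 'N(K) ->
  <<coset K y ^: (A / K)>> = A / K.
Proof.
move=> defA Ay nKA.
by rewrite -quotient_class -?quotient_gen ?class_subG ?(subsetP nKA) ?defA.
Qed.

Section FixedPoints.

Variable gT : finGroupType.
Implicit Types A B D G H K N R W X Y : {group gT}.

Lemma leq_card_meet W X Y :
  X \subset W -> Y \subset W -> #|X| * #|Y| <= #|W| * #|X :&: Y|.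
Proof.
by move=> sXW sYW; rewrite mul_cardG leq_mul2r subset_leq_card ?mul_subG ?orbT.
Qed.

(** [[~ y, s]] is [y^-1 * y ^ s], so it centralises the intersection of ['C_W[y]] and ['C_W[y ^ s]],
    two subgroups of equal order. *)
Lemma leq_card_cent_comm W y s :
  s \in 'N(W) -> #|'C_W[y]| ^ 2 <= #|W| * #|'C_W[[~ y, s]]|.
Proof.
move=> nWs; have oC: #|'C_W[y ^ s]| = #|'C_W[y]|.
  by rewrite -(cardJg 'C_W[y] s) conjIg (normP nWs) -cent1J.
rewrite -mulnn -{2}oC; apply: leq_trans (leq_card_meet (subsetIl _ _) (subsetIl _ _)) _.
rewrite leq_mul2l subset_leq_card ?orbT //.
apply/subsetP=> w /setIP[/setIP[Ww cyw] /setIP[_ cysw]].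
rewrite inE Ww cent1C commgEl groupM ?groupV //; first by rewrite cent1C.
by rewrite cent1C.
Qed.

(** As [z] commutes with [A] modulo the kernel ['C(W)], the subgroup ['C_W[z]] is [A]-invariant, and
    it is not all of [W]. *)
Lemma cent1_minnormal_TI A W z :
    minnormal W A -> z \in A -> z \notin 'C(W) ->
    (forall a, a \in A -> [~ z, a] \in 'C(W)) ->
  'C_W[z] = 1.
Proof.
move=> /mingroupP[/andP[ntW nWA] minW] Az cWz cza.
apply/eqP; apply: contraR cWz => ntC.
have nCA: A \subset 'N('C_W[z]).
  apply/subsetP=> a Aa; have nWa := subsetP nWA a Aa.
  suffices stabC w : w \in 'C_W[z] -> w ^ a \in 'C_W[z].
    by rewrite inE; apply/subsetP=> _ /imsetP[w Cw ->]; apply: stabC.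
  case/setIP=> Ww czw; rewrite inE memJ_norm // Ww /=; apply/cent1P.
  apply/commgP/conjg_fixP.
  have cwa: (w ^ a) ^ [~ a, z] = w ^ a.
    apply/conjg_fixP/commgP/esym.
    by apply: (centP (_ : _ \in 'C(W))); rewrite ?memJ_norm // -invg_comm groupV cza.
  have cwz: w ^ z = w by apply/conjg_fixP/commgP/cent1P.
  by rewrite -conjgM commgC (conjgM w (z * a)) (conjgM w z) cwz cwa.
rewrite -(minW 'C_W[z]%G) ?subsetIl ?ntC //.
by apply/centP=> w /setIP[_ /cent1P].
Qed.

(** The centraliser of [N / D] is normalised by [A] and contains the image of [y], hence that of the
    normal closure [A] of [y]. *)
Lemma class_gen_comm_sub A D N y :
    <<y ^: A>> = A -> y \in A -> A \subset 'N(D) -> A \subset 'N(N) ->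
    N \subset 'N(D) -> (forall m, m \in N -> [~ y, m] \in D) ->
  [~: A, N] \subset D.
Proof.
move=> defA Ay nDA nNA nDN cyN; have nDy := subsetP nDA y Ay.
rewrite -quotient_cents2 //.
apply: class_gen_subset (quotient_class_gen defA Ay nDA) _ _.
  exact/norms_cent/quotient_norms.
apply/centP=> _ /morphimP[m nDm Nm ->]; apply/commgP.
by rewrite -morphR //= coset_id ?cyN.
Qed.

(* Let N be minimal among the normal subgroups not contained in a maximal
   subgroup M >= B. Then M :&: N contains N', hence is normal in A, so an element
   of N outside M lies in no conjugate of M. If no [~ y, m] with m in N is such
   an element then M is normal in A, and y itself will do. *)
Lemma exists_fixfree_elt A B y :
    solvable A -> <<y ^: A>> = A -> y \in A -> B \proper A ->
  exists2 t, t = y \/ (exists2 m, m \in A & t = [~ y, m])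
           & t \in A /\ forall a, a \in A -> t \notin B :^ a.
Proof.
move=> solA defA Ay prBA.
have [sBA nsAB] := andP prBA.
case: (maximal_exists sBA) => [eqBA|[M maxM sBM]]; first by rewrite eqBA subxx in nsAB.
have [sMA nsAM] := andP (maxgroupp maxM).
suffices [t tP [At nMt]]: exists2 t, t = y \/ (exists2 m, m \in A & t = [~ y, m])
           & t \in A /\ forall a, a \in A -> t \notin M :^ a.
  exists t => //; split=> // a Aa; apply: contra (nMt a Aa).
  by apply: subsetP; rewrite conjSg.
have [/exists_inP[a0 Aa0 Mya0] | yM] := boolP [exists a in A, y \in M :^ a]; last first.
  exists y; [by left | split=> // a Aa].
  by apply: contra yM => Mya; apply/exists_inP; exists a.
pose P (N : {group gT}) := (N <| A) && ~~ (N \subset M).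
have [|N /mingroupP[/andP[nsNA nsNM] minN] _] := @mingroup_exists _ P A.
  by rewrite /P normal_refl.
have [sNA nNA] := andP nsNA.
have ntN : N :!=: 1 by apply: contraNneq nsNM => ->; apply: sub1G.
have sN'M: N^`(1) \subset M.
  have pN := sol_der1_proper solA sNA ntN.
  apply: contraTT pN => nsN'M; rewrite (minN N^`(1)%G) ?der_sub ?properxx //.
  by rewrite /P nsN'M (char_normal_trans (der_char _ _)).
have eqA: M * N = A.
  have nNM := subset_trans sMA nNA.
  rewrite -norm_joinEl //; apply/eqP; rewrite eqEsubset join_subG sMA sNA /=.
  have [_ /(_ (M <*> N)%G)] := maxgroupP maxM.
  rewrite joing_subl /= => eqM; apply: contraR nsNM => nsA.
  by rewrite -eqM ?joing_subr // properE join_subG sMA sNA nsA.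
pose D := (M :&: N)%G.
have sND: N^`(1) \subset D by rewrite subsetI sN'M der_sub.
have nDA: A \subset 'N(D).
  rewrite -eqA mulG_subG normsI ?normG ?(subset_trans sMA) //=.
  by rewrite sub_der1_norm ?subsetIr.
have [/forall_inP cyN | ] := boolP [forall m in N, [~ y, m] \in D].
  have sAND : [~: A, N] \subset D.
    apply: class_gen_comm_sub cyN => //; exact: subset_trans nDA.
  have nMA : A \subset 'N(M).
    rewrite -eqA mulG_subG normG -commg_subl.
    by apply: subset_trans (commSg _ sMA) (subset_trans sAND (subsetIl _ _)).
  case/negP: nsAM; apply: (class_gen_subset defA nMA).
  by rewrite -(normsP nMA a0 Aa0).
rewrite negb_forall_in => /exists_inP[m Nm nDym].
have [Am nNy] := (subsetP sNA m Nm, subsetP nNA y Ay).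
exists [~ y, m]; [by right; exists m | split=> [|a Aa]; first exact: groupR].
apply: contra nDym => Mat; rewrite -(normsP nDA a Aa) conjIg inE Mat /=.
by rewrite (normsP nNA a Aa) -groupV invg_comm commgEl groupM ?groupV ?memJ_norm.
Qed.

(** For [D] maximal, each point of [S] lies in [D], its image or its preimage, three sets of at most
    [#|D|] elements. *)
Lemma exists_disjoint_image (T : finType) (S : {set T}) (f : T -> T) :
    injective f -> (forall x, x \in S -> f x != x) ->
  exists D : {set T}, [/\ D \subset S, [disjoint D & f @: D] & #|S| <= 3 * #|D|].
Proof.
move=> injf fixfree.
pose P (D : {set T}) := (D \subset S) && [disjoint D & f @: D].
have [|D /maxsetP[/andP[sDS tiD] maxD] _] := @maxset_exists _ P set0.
  by rewrite /P sub0set -setI_eq0 set0I eqxx.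
exists D; split=> //.
suffices sSU: S \subset D :|: (f @: D :|: f @^-1: D).
  apply: leq_trans (subset_leq_card sSU) _.
  apply: leq_trans (leq_card_setU _ _) _; rewrite mulSn leq_add2l.
  apply: leq_trans (leq_card_setU _ _) _; rewrite mul2n -addnn.
  rewrite leq_add ?leq_imset_card // -(card_imset _ injf) subset_leq_card //.
  by apply/subsetP=> _ /imsetP[x Dfx ->]; rewrite inE in Dfx.
apply/subsetP=> x Sx; rewrite !inE.
have [//|Dx /=] := boolP (x \in D); apply/contraR: Dx.
rewrite negb_or => /andP[fDx Dfx].
suffices eqD: x |: D = D by rewrite -eqD setU11.
apply: maxD; last exact: subsetUr.
rewrite /P subUset sub1set Sx sDS /= -setI_eq0 -subset0; apply/subsetP=> z.
rewrite imsetU1 !inE => /andP[/orP[/eqP->|Dz] /orP[/eqP eqz|fDz]].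
- by have:= fixfree x Sx; rewrite -eqz eqxx.
- by rewrite fDz in fDx.
- by rewrite -eqz Dz in Dfx.
- by have/setP/(_ z) := disjoint_setI0 tiD; rewrite !inE Dz fDz.
Qed.

(* The subgroups 'C_W(L), for L conjugate to K, are independent and t permutes
   them without fixed points; if D is a set of conjugates of K with D disjoint
   from D :^ t, then 'C_W[t] meets the product of the 'C_W(L), L in D, trivially. *)
Lemma cent1_imprimitive A R K W t :
    minnormal W A -> abelian W -> R <| A -> R^`(1) \subset 'C(W) -> K \subset R ->
    'C_W(K) != 1 -> (forall L : {group gT}, L \subset R -> #|K| < #|L| -> 'C_W(L) = 1) ->
    t \in A -> (forall a, a \in A -> t \notin 'N(K) :^ a) ->
  #|'C_W[t]| ^ 3 <= #|W| ^ 2.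
Proof.
case/mingroupP=> /andP[ntW nWA] minW abW /andP[sRA nRA] cR'W sKR ntCK maxK At nKt.
have nWR := subset_trans sRA nWA.
(* Enlarging [L] by ['C_R(W)] does not change ['C_W(L)]; the enlarged group contains the derived
   subgroup of [R], so it is normal in [R]. *)
have nCR (L : {group gT}): L \subset R -> R \subset 'N('C_W(L)).
  move=> sLR; have -> : 'C_W(L) = 'C_W(L <*> 'C_R(W)).
    rewrite centY setIA; apply/esym/setIidPl.
    by rewrite (subset_trans (subsetIl _ _)) // centsC subsetIr.
  rewrite normsI ?norms_cent // sub_der1_norm ?join_subG ?sLR ?subsetIl //.
  by rewrite (subset_trans _ (joing_subr _ _)) // subsetI der_sub.
pose Om : {set {set gT}} := [set K :^ a | a in A].
have OmP (L : {set gT}) : L \in Om -> exists2 H : {group gT}, L = H & H \subset R /\ #|H| = #|K|.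
  case/imsetP=> a Aa ->; exists (K :^ a)%G; rewrite // cardJg; split=> //.
  by rewrite -(normsP nRA a Aa) conjSg.
have OmC (L : {set gT}) : L \in Om -> #|'C_W(L)| = #|'C_W(K)|.
  case/imsetP=> a Aa ->.
  by rewrite -(cardJg 'C_W(K) a) conjIg (normsP nWA) // centJ.
pose P (S : {set {set gT}}) : {group gT} := <<\bigcup_(L in S) 'C_W(L)>>%G.
have sPW S: P S \subset W by rewrite gen_subG; apply/bigcupsP=> L _; apply: subsetIl.
have nPR (S : {set {set gT}}): S \subset Om -> R \subset 'N(P S).
  move=> sSO; apply/norms_gen/norms_bigcup/bigcapsP=> L SL.
  by have [H -> [sHR _]] := OmP L (subsetP sSO L SL); apply: nCR.
(* Induction on [#|S|]: by maximality of [#|K|] two distinct conjugates of [K] have no common fixed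
   point but 1, so one more factor ['C_W(L1)] keeps the product direct. *)
have indep (S : {set {set gT}}): S \subset Om ->
  (forall L, L \in Om -> L \notin S -> 'C_(P S)(L) = 1) /\ #|P S| = (#|'C_W(K)| ^ #|S|)%N.
- have [m] := ubnP #|S|; elim: m S => // m IHm S /ltnSE-leSm sSO.
  have [->|[L1 SL1]] := set_0Vmem S.
    rewrite cards0 expn0 /P /= big_set0 gen0 cards1; split=> // L _ _.
    exact/trivgP/subsetIl.
  have OL1 := subsetP sSO L1 SL1; have [H1 eH1 [sH1R oH1]] := OmP _ OL1.
  pose S1 := S :\ L1; have sS1O: S1 \subset Om by apply: subset_trans sSO; apply: subsetDl.
  have S1L1 : L1 \notin S1 by rewrite !inE eqxx.
  have [|ti1 o1] := IHm S1 _ sS1O; first by rewrite (cardsD1 L1) SL1 in leSm.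
  have defP: P S :=: 'C_W(L1) * P S1.
    rewrite eH1 -cent_joinEl; last first.
      by rewrite (subset_trans (subsetIl _ _)) // (subset_trans abW) // centS.
    rewrite joing_idr /P /= -{1}(setD1K SL1) big_setU1 //= -eH1. done.
  have tiP: 'C_W(H1) :&: P S1 = 1.
    by apply/trivgP; rewrite -(ti1 L1) // eH1 subsetI subsetIr (subset_trans (subsetIl _ _)) ?subsetIr.
  have oP : #|P S| = (#|'C_W(K)| ^ #|S|)%N.
    by rewrite defP eH1 TI_cardMg // -eH1 OmC // o1 (cardsD1 L1 S) SL1 expnS.
  split=> // L OL SL; have [H eH [sHR oH]] := OmP _ OL.
  rewrite defP eH eH1 -subcent_TImulg //; last first.
    by rewrite subsetI !(subset_trans sHR) ?nCR ?nPR.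
  rewrite -eH ti1 ?mulg1 //; last by rewrite !inE (negPf SL) andbF.
  rewrite eH -setIA -centY maxK // ?join_subG ?sH1R // -oH1.
  rewrite proper_card // properE joing_subl join_subG subxx /=.
  apply: contra SL => sHH1; suffices -> : L = L1 by [].
  by apply/eqP; rewrite eH eH1 eqEcard sHH1 oH1 oH /=.
have PJ (S : {set {set gT}}) a: a \in A -> P S :^ a \subset P [set L :^ a | L in S].
  move=> Aa; rewrite -genJ gen_subG sub_conjg; apply/bigcupsP=> L SL.
  rewrite -sub_conjg conjIg -centJ (normsP nWA) //.
  by apply: sub_gen; apply: (bigcup_max (L :^ a)) => //; apply: imset_f.
have OmJ a : a \in A -> [set L :^ a | L in Om] \subset Om.
  move=> Aa; apply/subsetP=> _ /imsetP[_ /imsetP[b Ab ->] ->].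
  by rewrite -conjsgM imset_f ?groupM.
have defW: P Om :=: W.
  apply: minW => //; apply/andP; split.
    apply: contraNneq ntCK => P1; rewrite -subG1 -P1; apply: sub_gen.
    by apply: (bigcup_max (K : {set gT})) => //; apply/imsetP; exists 1; rewrite ?conjsg1.
  apply/subsetP=> a Aa; rewrite inE; apply: subset_trans (PJ _ _ Aa) _.
  rewrite genS //; apply/bigcupsP=> L /(subsetP (OmJ a Aa)) OL.
  exact: (bigcup_max L).
have [||D [sDO tiD leOD]] := @exists_disjoint_image _ Om (fun L => L :^ t).
- exact: conjsg_inj.
- move=> _ /imsetP[a Aa ->]; apply: contra (nKt a Aa) => /eqP eqK.
  by rewrite -normJ; apply/normP.
set fD := _ @: D in tiD.
have sfDO: fD \subset Om by apply: subset_trans (OmJ t At); apply: imsetS.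
have ofD: #|fD| = #|D| by apply/card_imset/conjsg_inj.
have w_gt0 : 0 < #|'C_W(K)| by apply: cardG_gt0.
have tiPD: P D :&: P fD = 1.
  have sDfO: D :|: fD \subset Om by rewrite subUset sDO.
  have [[[_ oD] [_ ofDw]] [_ oU]] := (indep _ sDO, indep _ sfDO, indep _ sDfO).
  have sU: P (D :|: fD) \subset P D * P fD.
    rewrite -cent_joinEl; last first.
      by rewrite (subset_trans (sPW _)) // (subset_trans abW) // centS.
    by rewrite /P /= bigcup_setU joing_idl joing_idr.
  have oU2: #|D :|: fD| = (#|D| + #|D|)%N.
    by rewrite cardsU disjoint_setI0 // cards0 subn0 ofD.
  apply: card_le1_trivg.
  rewrite -(leq_pmul2l (_ : 0 < #|P D * P fD|)); last first.
    exact: leq_trans (cardG_gt0 _) (subset_leq_card sU).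
  rewrite muln1 -mul_cardG oD ofDw ofD -expnD -oU2 -oU.
  exact: subset_leq_card.
have oW : #|W| = (#|'C_W(K)| ^ #|Om|)%N by rewrite -{1}defW; case: (indep _ (subxx Om)).
have [_ oD] := indep _ sDO.
(* An element of [P D] fixed by [t] equals its [t]-conjugate, which lies in [P fD]. *)
have tiC: 'C_W[t] :&: P D = 1.
  apply/trivgP; rewrite -tiPD; apply/subsetP=> v /setIP[/setIP[_ ctv] Pv].
  rewrite inE Pv; have <- : v ^ t = v by apply/conjg_fixP/commgP/cent1P.
  by apply: (subsetP (PJ D t At)); rewrite memJ_conjg.
(* With c = [#|'C_W(K)|] this gives [#|'C_W[t]|] c^[#|D|] <= [#|W|] = c^[#|Om|]. It is cubed,
   [#|Om| <= 3 * #|D|] is used, and one factor [#|W|] cancels. *)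
have:= leq_card_meet (subsetIl W 'C[t]) (sPW D).
rewrite tiC cards1 muln1 oD oW => leC.
have wn_gt0: 0 < #|'C_W(K)| ^ #|Om| by rewrite expn_gt0 w_gt0.
rewrite -(leq_pmul2r wn_gt0) -expnSr.
apply: leq_trans (_ : (#|'C_W[t]| * #|'C_W(K)| ^ #|D|) ^ 3 <= _); last by rewrite leq_exp2r.
by rewrite expnMn leq_mul2l -expnM mulnC leq_pexp2l ?orbT.
Qed.

(* Let R be a normal subgroup of A minimal subject to [A, R] acting nontrivially
   on W. If R acts as a nonabelian group then some commutator of elements of R
   acts on W as a nontrivial central element of A, hence without fixed points;
   otherwise W decomposes into the 'C_W(K^a), with K <= R of maximal order such
   that 'C_W(K) is nontrivial. *)
Lemma exists_small_cent1 A W y :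
    solvable A -> <<y ^: A>> = A -> y \in A ->
    minnormal W A -> abelian W -> ~~ (A \subset 'C(W)) ->
  exists2 t, t = y \/ (exists2 s, s \in A & t = [~ y, s])
           & #|'C_W[t]| ^ 3 <= #|W| ^ 2.
Proof.
move=> solA defA Ay minWA abW nCWA.
have [/andP[ntW nWA] minW] := mingroupP minWA.
have nZA : A \subset 'N('C(W)) by apply: norms_cent.
have W2_gt0 : 0 < #|W| ^ 2 by rewrite expn_gt0 cardG_gt0.
have y_nC : y \notin 'C(W) by apply: contra nCWA; apply: class_gen_subset.
have [cAA | ncAA] := boolP ([~: A, A] \subset 'C(W)).
  exists y; first by left.
  rewrite (@cent1_minnormal_TI A) ?cards1 ?exp1n // => a Aa.
  by rewrite (subsetP cAA) ?mem_commg.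
pose P (N : {group gT}) := (N <| A) && ~~ ([~: A, N] \subset 'C(W)).
have [|R /mingroupP[/andP[nsRA ncAR] minR] _] := @mingroup_exists _ P A.
  by rewrite /P normal_refl.
have [sRA nRA] := andP nsRA.
have cAN (N : {group gT}) : N <| A -> N \proper R -> [~: A, N] \subset 'C(W).
  move=> nsNA /andP[sNR nsRN]; apply: contraR nsRN => ncAN.
  by rewrite (minR N) // /P nsNA.
have [s Rs ncys]: exists2 s, s \in R & [~ y, s] \notin 'C(W).
  apply/exists_inP; rewrite -[[exists _ in _, _]]negbK negb_exists_in.
  apply: contra ncAR => /forall_inP cyR.
  apply: (class_gen_comm_sub defA Ay) => //; first exact: subset_trans nZA.
  by move=> m Rm; rewrite -[_ \in _]negbK cyR.
have [As nRy] := (subsetP sRA s Rs, subsetP nRA y Ay).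
set t := [~ y, s] in ncys.
have tP : t = y \/ (exists2 s, s \in A & t = [~ y, s]) by right; exists s.
have Rt : t \in R by rewrite /t commgEr groupM // memJ_norm ?groupV.
have At := subsetP sRA t Rt.
have [cR' | ncR'] := boolP (R^`(1) \subset 'C(W)).
  pose Q (K : {group gT}) := (K \subset R) && ('C_W(K) != 1).
  have Q1 : Q 1%G by rewrite /Q sub1G cent1T setIT.
  case: (arg_maxnP (fun K : {group gT} => #|K|) Q1) => K /andP[sKR ntCK] maxK.
  have {}maxK (L : {group gT}) : L \subset R -> #|K| < #|L| -> 'C_W(L) = 1.
    move=> sLR; rewrite ltnNge => /negP leLK; apply/eqP/negPn/negP=> ntC.
    by apply/leLK/maxK; rewrite /Q sLR.
  (* If [A] normalises [K], then [K] centralises [W] by irreducibility. So [t] lies outside [K], and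
     [K <*> <[t]>] is too large to have fixed points. *)
  have [nKA | nnKA] := boolP (A \subset 'N(K)).
    exists t => //; have cWK : W \subset 'C(K).
      apply/setIidPl/minW; last exact: subsetIl.
      by rewrite ntCK normsI ?norms_cent.
    rewrite -{1}(setIidPl cWK) -setIA -cent_cycle -centY.
    rewrite (maxK (K <*> <[t]>)%G) ?cards1 ?exp1n //.
      by rewrite join_subG sKR cycle_subG.
    rewrite proper_card // properE joing_subl join_subG subxx cycle_subG /=.
    by apply: contra ncys; apply: subsetP; rewrite centsC.
  have [|u uP [Au nBu]] := exists_fixfree_elt (B := 'N_A(K)%G) solA defA Ay.
    by rewrite properE subsetIl subsetI subxx.
  exists u => //; apply: (@cent1_imprimitive A R K) => // a Aa.
  by apply: contra (nBu a Aa) => nKu; rewrite conjIg inE nKu conjGid // Au.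
(* [R1] consists of the elements of [R] that act on [W] as central elements of [R]. It is proper, so
   by minimality of [R] the group [A] centralises it modulo ['C(W)]. *)
pose R1 := (R :&: coset 'C(W) @*^-1 'C(R / 'C(W)))%G.
have nZR := subset_trans sRA nZA.
have R1P r : (r \in R1) = (r \in R) && [forall u in R, [~ r, u] \in 'C(W)].
  rewrite inE; have [Rr /= | //] := boolP (r \in R).
  have nZr := subsetP nZR r Rr; rewrite in_setI nZr /= in_set.
  apply/centP/forall_inP => [cr u Ru | cr _ /morphimP[u nZu Ru ->]].
    have nZu := subsetP nZR u Ru; apply: coset_idr; first by rewrite groupR.
    by rewrite morphR //; apply/eqP/commgP/cr; rewrite mem_quotient.
  by apply/commgP; rewrite -morphR //= coset_id ?cr.
have ltR1 : R1 \proper R.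
  rewrite properE subsetIl /=; apply: contra ncR' => /subsetP sRR1.
  rewrite gen_subG; apply/subsetP=> _ /imset2P[r u Rr Ru ->].
  by have:= sRR1 r Rr; rewrite R1P Rr => /forall_inP->.
have nsR1 : R1 <| A.
  rewrite /normal (subset_trans (subsetIl _ _)) //= normsI //.
  apply: subset_trans (morphpre_norms _ (norms_cent (quotient_norms _ nRA))).
  by rewrite -sub_morphim_pre.
exists t => //.
have [ctR | nctR] := boolP (t \in R1).
  rewrite (@cent1_minnormal_TI A) ?cards1 ?exp1n // => a Aa.
  rewrite -groupV invg_comm (subsetP (cAN _ nsR1 ltR1)) //.
  by rewrite mem_commg.
(* Here [[~ t, u]] lies in the derived subgroup of [R], which is proper by solvability and so
   central in [A] modulo ['C(W)]. Hence [[~ t, u]] has no fixed points, and [#|'C_W[t]| ^ 2 <=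
   #|W|]. *)
move: nctR; rewrite R1P Rt negb_forall_in => /exists_inP[u Ru nctu].
have Au := subsetP sRA u Ru.
have ntR : R :!=: 1 by apply: contraNneq ncR' => ->; rewrite derg1 commG1 sub1G.
have cR'A := cAN _ (char_normal_trans (der_char 1 R) nsRA) (sol_der1_proper solA sRA ntR).
have := leq_card_cent_comm t (subsetP nWA u Au).
rewrite (cent1_minnormal_TI minWA (groupR At Au) nctu) => [|a Aa]; last first.
  by rewrite -groupV invg_comm (subsetP cR'A) // mem_commg // mem_commg.
rewrite cards1 muln1 => le_t; rewrite expnS mulnC [in X in _ <= X]expnS leq_mul //.
exact: subset_leq_card (subsetIl _ _).
Qed.

(** For [t = y] the square of the bound on [t] suffices. For [t = [~ y, s]] one cubes [#|'C_W[y]| ^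
    2 <= #|W| * #|'C_W[t]|] and inserts the bound. *)
Lemma leq_card_cent1_minnormal A W y :
    solvable A -> <<y ^: A>> = A -> y \in A ->
    minnormal W A -> abelian W -> ~~ (A \subset 'C(W)) ->
  #|'C_W[y]| ^ 6 <= #|W| ^ 5.
Proof.
move=> solA defA Ay minWA abW nCWA; have [/andP[_ nWA] _] := mingroupP minWA.
have W_gt0 := cardG_gt0 W.
have [_ [->|[s As ->]] le_t] := exists_small_cent1 solA defA Ay minWA abW nCWA.
  apply: leq_trans (_ : (#|W| ^ 2) ^ 2 <= _); last by rewrite -expnM leq_pexp2l.
  by rewrite -[6]/(3 * 2)%N expnM leq_exp2r.
have le_y := leq_card_cent_comm y (subsetP nWA s As).
rewrite -[6]/(2 * 3)%N expnM; apply: leq_trans (_ : (#|W| * #|'C_W[[~ y, s]]|) ^ 3 <= _).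
  by rewrite leq_exp2r.
by rewrite expnMn -[5]/(3 + 2)%N expnD leq_mul2l le_t orbT.
Qed.

End FixedPoints.

(** * Generating subgroups of maximal Fitting height *)

Lemma nilpotent_pcore_Hall_join (gT : finGroupType) (p : nat) (T W : {group gT}) :
    nilpotent T -> p.-group W -> T \subset 'N(W) ->
  p^'.-Hall(T <*> W) 'O_p^'(T).
Proof.
move=> nilT pW nWT; have /and3P[sOT p'O pTO] := nilpotent_pcore_Hall p^' nilT.
rewrite /pHall (subset_trans sOT (joing_subl _ _)) p'O /=.
rewrite -(Lagrange_index (joing_subl T W)) // pnatM pTO andbT pnatNK.
rewrite /= norm_joinEl // indexMg.
exact: pnat_dvd (dvdn_indexg _ _) pW.
Qed.

(** * Hall conjugacy and the number of conjugators *)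

Section Conjugates.

Variables (gT : finGroupType) (n h j p : nat) (A W : {group gT}) (y : 'I_j -> gT).

(** The two generated groups agree modulo [W], so the p'-cores of their residuals are Hall subgroups
    of the same group [T <*> W], hence conjugate by some [v] in [W], as [T] normalises its own core
    H. Both [y i] and its conjugate by [w i * v^-1] normalise H, so their quotient lies in N_W(H) =
    C_W(H) = 1. *)
Lemma common_conjugator (w : 'I_j -> gT) :
    solvable A -> abelian W -> p.-group W -> A \subset 'N(W) ->
    <<[set y i | i : 'I_j]>> = A ->
    (forall i, w i \in W) ->
    nilpotent (nilres n h A) ->
    nilpotent (nilres n h <<[set y i ^ w i | i : 'I_j]>>%G) ->
    'C_W('O_p^'(nilres n h A)) = 1 ->
  exists2 v, v \in W & forall i, w i * v^-1 \in 'C_W[y i].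
Proof.
set B := <<[set y i ^ w i | i : 'I_j]>>%G; set T := nilres n h A; set TB := nilres n h B.
move=> solA abW pW nWA defA Ww nilT nilTB tiC.
have Ay i : y i \in A by rewrite -defA mem_gen ?imset_f.
have nWy i := subsetP nWA _ (Ay i).
have nWw i := subsetP (normG W) _ (Ww i).
have nWB: B \subset 'N(W).
  by rewrite gen_subG; apply/subsetP=> _ /imsetP[i _ ->]; rewrite groupJ.
have sYN: [set y i | i : 'I_j] \subset 'N(W).
  by apply/subsetP=> _ /imsetP[i _ ->].
have eqAB : (A / W)%G = (B / W)%G.
  apply: group_inj; rewrite /= -defA !quotient_gen //; last first.
    exact: subset_trans (subset_gen _) nWB.
  congr <<_>>; rewrite /quotient !morphimEsub //; last first.
    exact: subset_trans (subset_gen _) nWB.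
  rewrite -!imset_comp; apply: eq_imset => i /=.
  by rewrite morphJ //= (coset_id (Ww i)) conjg1.
have nWT : T \subset 'N(W) := subset_trans (nilres_sub _ _ _) nWA.
have nWTB : TB \subset 'N(W) := subset_trans (nilres_sub _ _ _) nWB.
have eqTW : TB <*> W = T <*> W.
  rewrite -!(joingC W) !norm_joinEr // -!quotientK //; congr (_ @*^-1 _).
  by rewrite -!quotient_nilres // eqAB.
have hallT := nilpotent_pcore_Hall_join nilT pW nWT.
have hallTB := nilpotent_pcore_Hall_join nilTB pW nWTB.
rewrite eqTW in hallTB.
have solTW: solvable (T <*> W).
  have nsW: W <| T <*> W by rewrite /normal joing_subr join_subG nWT normG.
  rewrite (series_sol nsW) abelian_sol //= quotientYidr //.
  by rewrite quotient_sol ?nilpotent_sol.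
have [g Tg defH] := Hall_trans solTW hallTB hallT.
have /mulsgP[t v Tt Wv defg]: g \in T * W by rewrite -norm_joinEl.
have {}defH : 'O_p^'(TB) = 'O_p^'(T) :^ v.
  by rewrite defH defg conjsgM (normP (subsetP (gFnorm _ _) t Tt)).
exists v => // i.
have nHA : A \subset 'N('O_p^'(T)).
  exact: char_norm_trans (pcore_char _ _) (char_norm (nilres_char _ _ _)).
have nHB : B \subset 'N('O_p^'(TB)).
  exact: char_norm_trans (pcore_char _ _) (char_norm (nilres_char _ _ _)).
have Wwv : w i * v^-1 \in W by rewrite groupM ?groupV.
have nHyw : y i ^ (w i * v^-1) \in 'N('O_p^'(T)).
  rewrite conjgM -mem_conjg -normJ -defH (subsetP nHB) // mem_gen //.
  exact: imset_f.
rewrite inE Wwv cent1C; apply/cent1P/commgP.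
have nHyi := subsetP nHA _ (Ay i).
have : [~ y i, w i * v^-1] \in 'N_W('O_p^'(T)).
  rewrite inE {1}commgEr groupM ?memJ_norm ?groupV //=.
  by rewrite commgEl groupM ?groupV.
suffices -> : 'N_W('O_p^'(T)) = 1 by move/set1P/eqP.
apply/trivgP; rewrite -tiC subsetI subsetIl /=.
have coWO : coprime #|W| #|'O_p^'(T)| := pnat_coprime pW (pcore_pgroup _ _).
apply/commG1P/trivgP; rewrite -(coprime_TIg coWO).
by rewrite commg_subI // subsetI subxx (subset_trans (pcore_sub _ _)).
Qed.

(** Each family [w] is recovered from [v] and the family [w i * v^-1]; there are [#|W| * c ^ j] such
    pairs. *)
Lemma leq_card_conjugator c :
  (forall i, #|'C_W[y i]| = c) ->
  (forall w : 'I_j -> gT, (forall i, w i \in W) ->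
    exists2 v, v \in W & forall i, w i * v^-1 \in 'C_W[y i]) ->
  #|W| ^ j <= #|W| * c ^ j.
Proof.
move=> oC exv.
pose f (u : gT * {ffun 'I_j -> gT}) : {ffun 'I_j -> gT} := [ffun i => u.2 i * u.1].
pose Cy := [set d : {ffun 'I_j -> gT} | d \in family (fun i => mem 'C_W[y i])].
have oCy : #|Cy| = (c ^ j)%N.
  rewrite cardsE card_family.
  transitivity (foldr muln 1%N (nseq j c)); last by elim: j => //= m ->; rewrite expnS.
  congr foldr; rewrite -[j in nseq j]card_ord cardE.
  by rewrite /image_mem; elim: (enum _) => //= i s ->; rewrite oC.
rewrite -{1}(card_ord j) -card_ffun_on -oCy -cardsX.
apply: leq_trans (leq_imset_card f _); apply: subset_leq_card.
apply/subsetP=> w /ffun_onP Ww; have [v Wv Cwv] := exv w Ww.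
apply/imsetP; exists (v, [ffun i => w i * v^-1]).
  by rewrite in_setX Wv in_set; apply/familyP=> i; rewrite ffunE.
by apply/ffunP=> i; rewrite !ffunE /= ?ffunE mulgKV.
Qed.

End Conjugates.

(** * Seven conjugates generate a minimal group of given height *)

(** 7 is the least j with 5j < 6(j - 1), which makes |W|^(j-1) <= |C|^j incompatible with |C|^6 <=
    |W|^5 for nontrivial W. Repetitions are allowed. *)
Definition few_class_generators (gT : finGroupType) (M : {group gT}) (x : gT) :=
  exists y : 'I_7 -> gT,
    (forall i, y i \in x ^: M) /\ <<[set y i | i : 'I_7]>> = M.

(** A nontrivial [nilres n h M] means Fitting height greater than [h]. Minimality is asked only
    among subgroups generated by parts of the class. As a predicate it can be assumed for a quotient
    with the same [n]. *)
Definition minimal_generators_few n h (gT : finGroupType) (M : {group gT}) (x : gT) :=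
  #|M| <= n -> solvable M -> x \in M -> <<x ^: M>> = M -> nilres n h M :!=: 1 ->
  (forall S : {set gT}, S \subset x ^: M -> nilres n h <<S>>%G :!=: 1 -> <<S>> = M) ->
  few_class_generators M x.

(** Parts of the class lift from [M / K], where a residual is trivial exactly when the residual
    above lies in [K]. By minimality the lifted generators then generate [M] itself, not only [M]
    modulo [K]. *)
Lemma minimal_generators_few_lift n h (gT : finGroupType) (M K : {group gT}) x :
    minimal_generators_few n h (M / K)%G (coset K x) ->
    #|M| <= n -> solvable M -> x \in M -> <<x ^: M>> = M -> M \subset 'N(K) ->
    ~~ (nilres n h M \subset K) ->
    (forall S : {set gT}, S \subset x ^: M ->
      ~~ (nilres n h <<S>>%G \subset K) -> <<S>> = M) ->
  few_class_generators M x.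
Proof.
move=> fewMK leMn solM Mx defM nKM nsMK minM.
have sCM : x ^: M \subset M by rewrite class_subG.
have nKx := subsetP nKM x Mx.
have genq (S : {set gT}): S \subset x ^: M -> <<S>> / K = <<coset K @: S>>.
  move=> sSC; have nKS := subset_trans sSC (subset_trans sCM nKM).
  by rewrite quotient_gen // /quotient morphimEsub.
have resq (S : {set gT}) (H : {group coset_of K}) :
    S \subset x ^: M -> <<coset K @: S>> = H ->
  (nilres n h <<S>>%G \subset K) = (nilres n h H :==: 1).
- move=> sSC defH; have nKS : <<S>> \subset 'N(K).
    by rewrite gen_subG (subset_trans sSC) // (subset_trans sCM).
  have -> : H = (<<S>> / K)%G by apply: group_inj; rewrite /= genq.
  rewrite quotient_nilres // -subG1 quotient_sub1 //.
  exact: subset_trans (nilres_sub _ _ _) nKS.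
have defC : coset K x ^: (M / K) = coset K @: (x ^: M).
  by rewrite -quotient_class // /quotient morphimEsub // (subset_trans sCM).
have [||||||yq [yqC defy]] := fewMK.
- exact: leq_trans (leq_quotient _ _) leMn.
- exact: quotient_sol.
- exact: mem_quotient.
- exact: quotient_class_gen.
- by rewrite quotient_nilres // -subG1 quotient_sub1 // (subset_trans (nilres_sub _ _ _)).
- move=> S; rewrite defC => sSC ntS; pose S1 := x ^: M :&: coset K @^-1: S.
  have sS1 : S1 \subset x ^: M by apply: subsetIl.
  have defS : coset K @: S1 = S.
    apply/setP=> s; apply/imsetP/idP=> [[z /setIP[_]] | Ss]; first by rewrite inE => ? ->.
    have /imsetP[z Cz def_s] := subsetP sSC s Ss.
    by exists z; rewrite // !inE Cz -def_s.
  rewrite -defS -genq // (minM S1) //.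
  by rewrite (resq _ <<S>>%G) //= defS.
have /fin_all_exists2[y yC def_yq] (i : 'I_7) : exists2 z, z \in x ^: M & yq i = coset K z.
  by apply/imsetP; rewrite -defC.
exists y; split=> //; have sYC : [set y i | i : 'I_7] \subset x ^: M.
  by apply/subsetP=> _ /imsetP[i _ ->].
apply: minM => //; rewrite (resq _ (M / K)%G) //.
  by rewrite quotient_nilres // -subG1 quotient_sub1 // (subset_trans (nilres_sub _ _ _)).
by rewrite -defy -imset_comp; congr <<_>>; apply: eq_imset => i; rewrite /= def_yq.
Qed.

Lemma minimal_generators_fewP n h (gT : finGroupType) (M : {group gT}) x :
  minimal_generators_few n h M x.
Proof.
elim: h => [|h IHh] in gT M x *.
  (* For [h = 0] the residual is the group itself, so minimality makes [M] cyclic, generated by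
     [x]. *)
  move=> leMn solM Mx defM ntM minM; exists (fun=> x); split=> [_|].
    exact: class_refl.
  apply: minM; first by apply/subsetP=> _ /imsetP[i _ ->]; apply: class_refl.
  have Sx : x \in <<[set x | i : 'I_7]>>.
    by rewrite mem_gen //; apply/imsetP; exists ord0.
  apply: contraNneq ntM => /= gen1; rewrite gen1 in Sx.
  by apply/eqP/trivgP; rewrite /= -defM gen_subG class_sub_norm ?norms1.
have [m] := ubnP #|M|; elim: m => // m IHm in gT M x * => /ltnSE-leMm.
move=> leMn solM Mx defM ntK minM.
have ntM : M :!=: 1.
  by apply: contraNneq ntK => M1; rewrite -subG1 -M1 nilres_sub.
have [V minV sVM] := minnormal_exists ntM (normG M).
have [nVM ntV /is_abelemP[p p_pr /and3P[pV abV _]]] := minnormal_solvable minV sVM solM.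
have [_ minV'] := mingroupP minV.
(* If the residual survives in [M / V], induction on the order applies; otherwise it equals [V]. *)
have [sKV | nsKV] := boolP (nilres n h.+1 M \subset V); last first.
  apply: (@minimal_generators_few_lift n h.+1 _ _ V) => // [|S sSC nsSV].
    by apply: IHm; rewrite (leq_trans _ leMm) // ltn_quotient.
  by apply: minM => //; apply: contra nsSV => /eqP->; apply: sub1G.
pose N := nilres n h M.
have chN : N \char M := nilres_char _ _ _.
have sNM := char_sub chN.
have leNn : #|N| <= n := leq_trans (subset_leq_card sNM) leMn.
have defV : 'L_n.+1(N) = V.
  by apply: minV' => //; rewrite ntK (char_norm (nilres_char n h.+1 M)).
have ncNV : ~~ (N \subset 'C(V)).
  apply: contra ntK => cNV; rewrite nilresS /= lcn_card_nil //.
  apply/lcnP; exists n.+1; rewrite lcnSn defV; apply/commG1P.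
  by rewrite centsC.
have nVN := subset_trans sNM nVM.
have sVN : V \subset N by rewrite -defV lcn_sub.
have nsVN : V <| N by apply/andP.
(* [N / V] is nilpotent, so the p-core of [N] is Sylow in [N]; [V] meets its centre, hence lies in
   it by minimality. *)
have cPV (Q : {group gT}): Q \subset N -> p.-group Q -> Q \subset 'C(V).
  move=> sQN pQ; pose P := 'O_p(N)%G.
  have sVP : V \subset P by apply: pcore_max.
  have sylP : p.-Sylow(N) P.
    rewrite -(pquotient_pHall pV nsVN); last by rewrite /normal sVP (subset_trans (pcore_sub _ _)).
    rewrite /= -pquotient_pcore //; apply: nilpotent_pcore_Hall.
    apply/lcnP; exists n; have -> : 'L_n.+1(N / V) = 'L_n.+1(N) / V.
      exact/esym/(morphim_lcn (coset_morphism V)).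
    by rewrite defV trivg_quotient.
  have nMP : M \subset 'N(P) by apply: char_norm_trans (pcore_char _ _) (char_norm chN).
  have sQP : Q \subset P by rewrite (sub_normal_Hall sylP) ?pcore_normal.
  apply: subset_trans sQP _; rewrite centsC; apply/setIidPl.
  apply: minV'; last exact: subsetIl.
  rewrite normsI ?norms_cent // andbT.
  have nilP : nilpotent P := pgroup_nil (pcore_pgroup _ _).
  apply: contraNneq (meet_center_nil nilP (normalS sVP (pcore_sub _ _) nsVN) ntV).
  by rewrite -subG1 => <-; rewrite setIS ?subsetIr.
(* [A] has least order among the groups generated by conjugates whose [h]-th residual acts
   nontrivially on [V]; this is the minimality needed for the induction hypothesis modulo
   ['C(V)]. *)
pose Q (S : {set gT}) := (S \subset x ^: M) && ~~ (nilres n h <<S>>%G \subset 'C(V)).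
have QM : Q (x ^: M) by rewrite /Q subxx (group_inj (defM : <<_>>%G :=: M)).
case: (arg_minnP (fun S : {set gT} => #|<<S>>|) QM) => S0 /andP[sS0C ncS0] leS0.
pose A := <<S0>>%G.
have minA (S : {set gT}) : S \subset x ^: M -> <<S>> \subset A ->
    ~~ (nilres n h <<S>>%G \subset 'C(V)) -> <<S>> = A.
  by move=> sSC sSA ncS; apply/eqP; rewrite eqEcard sSA leS0 // /Q sSC.
have sCM : x ^: M \subset M by rewrite class_subG.
have sAM : A \subset M by rewrite gen_subG (subset_trans sS0C).
have leAn : #|A| <= n := leq_trans (subset_leq_card sAM) leMn.
have solA : solvable A := solvableS sAM solM.
have [y S0y ncy] : exists2 y, y \in S0 & ~~ (nilres n h <<y ^: A>>%G \subset 'C(V)).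
  apply/exists_inP; rewrite -[[exists _ in _, _]]negbK negb_exists_in.
  apply: contra ncS0 => /forall_inP cS0; apply: (@nilres_class_gen n h gT A 'C(V) S0) => // s S0s.
  by have:= cS0 s S0s; rewrite negbK.
have Ay : y \in A by rewrite mem_gen.
have sCAC : y ^: A \subset x ^: M.
  by rewrite -(class_eqP (subsetP sS0C y S0y)) imsetS.
have defA : <<y ^: A>> = A by apply: minA; rewrite // gen_subG class_subG.
have nVA := subset_trans sAM nVM.
have [|||ys [ysC defYs]] := @minimal_generators_few_lift n h gT A 'C(V) y (IHh _ _ _) leAn solA Ay defA.
- exact: norms_cent.
- exact: ncS0.
- move=> S sSC; apply: minA; first exact: subset_trans sCAC.
  by rewrite gen_subG (subset_trans sSC) ?class_subG.
set T := nilres n h A in ncS0 *.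
have sTN : T \subset N := nilres_mono _ _ sAM.
have sTA : T \subset A := nilres_sub _ _ _.
pose B (w : {ffun 'I_7 -> gT}) := <<[set ys i ^ w i | i : 'I_7]>>%G.
(* If some [B w] has a nontrivial residual at [h.+1], minimality gives [B w = M]. Otherwise all
   their [h]-th residuals are nilpotent, and trivial [w] yields this for [T]. *)
have [/existsP[w /andP[/forallP Vw ntB]] | no_w] :=
    boolP [exists w : {ffun 'I_7 -> gT},
             [forall i, w i \in V] && (nilres n h.+1 (B w) != 1 :> {set gT})].
  have Cw i : ys i ^ w i \in x ^: M.
    have /imsetP[g Mg ->] := subsetP sCAC _ (ysC i).
    by rewrite -conjgM imset_f ?groupM // (subsetP sVM).
  exists (fun i => ys i ^ w i); split=> //.
  by apply: minM => //; apply/subsetP=> _ /imsetP[i _ ->].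
have nilB (w : 'I_7 -> gT) : (forall i, w i \in V) ->
    nilpotent (nilres n h <<[set ys i ^ w i | i : 'I_7]>>%G).
  move=> Vw; have -> : <<[set ys i ^ w i | i : 'I_7]>>%G = B (finfun w).
    by apply: group_inj => /=; congr <<_>>; apply: eq_imset => i; rewrite ffunE.
  apply: nilpotent_nilres; apply/eqP; apply: contraR no_w => ntB.
  apply/existsP; exists (finfun w); rewrite ntB andbT.
  by apply/forallP=> i; rewrite ffunE.
have nilT : nilpotent T.
  have := nilB (fun=> 1) (fun=> group1 V).
  suffices -> : <<[set ys i ^ 1 | i : 'I_7]>>%G = A by [].
  by apply: group_inj; rewrite /= -defYs; congr <<_>>; apply: eq_imset => i; rewrite conjg1.
(* The p-part of [T] centralises [V], so the p'-part [H] does not. By coprime action [H] has no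
   fixed points on [[~: V, H]], where [W] is chosen. *)
pose H := 'O_p^'(T)%G.
have ncH : ~~ (H \subset 'C(V)).
  apply: contra ncS0 => cHV; have /dprodP[_ <- _ _] := nilpotent_pcoreC p nilT.
  rewrite mulG_subG cHV andbT cPV ?pcore_pgroup //.
  exact: subset_trans (pcore_sub _ _) sTN.
have sHA : H \subset A := subset_trans (pcore_sub _ _) sTA.
have nHA : A \subset 'N(H).
  exact: char_norm_trans (pcore_char _ _) (char_norm (nilres_char _ _ _)).
have nVH := subset_trans sHA nVA.
have ntVH : [~: V, H] != 1.
  by apply: contra ncH => /eqP/commG1P; rewrite centsC.
have [W minW sWVH] := minnormal_exists ntVH (normsR nVA nHA).
have sWV : W \subset V by rewrite (subset_trans sWVH) // commg_subl.
have tiC : 'C_W(H) = 1.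
  apply/trivgP; rewrite -(coprime_abel_cent_TI nVH _ abV) ?setSI //.
  exact: pnat_coprime pV (pcore_pgroup _ _).
have [/andP[ntW nWA] _] := mingroupP minW.
have abW := abelianS sWV abV.
have ncAW : ~~ (A \subset 'C(W)).
  apply: contra ntW => cAW; rewrite -tiC; apply/eqP/esym/setIidPl.
  by rewrite centsC (subset_trans sHA).
have oC i : #|'C_W[ys i]| = #|'C_W[y]|.
  have /imsetP[a Aa ->] := ysC i.
  by rewrite -(cardJg 'C_W[y] a) conjIg (normsP nWA) // -cent1J.
have le6 := leq_card_cent1_minnormal solA defA Ay minW abW ncAW.
have le7 : #|W| ^ 7 <= #|W| * #|'C_W[y]| ^ 7.
  apply: leq_card_conjugator oC _ => w Ww.
  apply: (@common_conjugator gT n h 7 p A W ys) => //; first exact: pgroupS pV.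
  by apply: nilB => i; apply: (subsetP sWV).
case/negP: ntW; rewrite trivg_card_le1 leqNgt; apply/negP=> W_gt1.
have W_gt0 := ltnW W_gt1.
rewrite expnS leq_pmul2l // in le7.
(* The sixth power of |W|^6 <= |C|^7 meets the seventh power of |C|^6 <= |W|^5. *)
have : #|W| ^ 36 <= #|W| ^ 35.
  rewrite -[36]/(6 * 6)%N -[35]/(5 * 7)%N !expnM.
  apply: leq_trans (_ : (#|'C_W[y]| ^ 7) ^ 6 <= _); first by rewrite leq_exp2r.
  by rewrite -expnM mulnC expnM leq_exp2r.
by rewrite leq_exp2l.
Qed.

(** * The solvability criterion, by Baer-Suzuki *)

Lemma class_gen_solvable (gT : finGroupType) (G : {group gT}) x :
    x \in G ->
    (forall S : {set gT}, S \subset x ^: G -> #|S| <= 14 -> solvable <<S>>) ->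
  solvable <<x ^: G>>.
Proof.
have [m] := ubnP #|G|; elim: m => // m IHm in gT G x * => /ltnSE-leGm Gx solS.
have [->|ntx] := eqVneq x 1.
  by rewrite class1G genGid solvable1.
pose n := #|G|.
have leGn (H : {group gT}) : H \subset G -> #|H| <= n by apply: subset_leq_card.
have sCG : x ^: G \subset G by rewrite class_subG.
(* [P h] asks for Fitting height greater than [h], so the maximal [h] is one less than the maximal
   height. *)
pose P h := [exists S : {set gT},
  [&& S \subset x ^: G, #|S| <= 14 & nilres n h <<S>>%G != 1 :> {set gT}]].
have P0 : P 0.
  apply/existsP; exists [set x]; rewrite sub1set class_refl cards1 /=.
  by rewrite -cycle_eq1 in ntx.
have Ple h : P h -> h <= n.
  case/existsP=> S /and3P[sSC leS ntS]; rewrite leqNgt; apply: contra ntS => lt_nh.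
  rewrite solvable_nilres1 ?solS // ?cardG_gt0 //.
  by rewrite (leq_trans _ (ltnW lt_nh)) // leGn // gen_subG (subset_trans sSC).
have [h /existsP[S0 /and3P[sS0C leS0 ntS0]] maxh] := ex_maxnP (ex_intro _ 0 P0) Ple.
pose Q (S : {set gT}) :=
  [&& S \subset x ^: G, <<S>> \subset <<S0>> & nilres n h <<S>>%G != 1 :> {set gT}].
have Q0 : Q S0 by rewrite /Q sS0C ntS0 subxx.
case: (arg_minnP (fun S : {set gT} => #|<<S>>|) Q0) => S /and3P[sSC sSS0 ntS] minS.
pose M := <<S>>%G.
have sMG : M \subset G by rewrite gen_subG (subset_trans sSC).
have solM : solvable M := solvableS sSS0 (solS _ sS0C leS0).
have minM (S' : {set gT}) : S' \subset x ^: G -> <<S'>> \subset M ->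
    nilres n h <<S'>>%G :!=: 1 -> <<S'>> = M.
  move=> sS'C sS'M ntS'; apply/eqP; rewrite eqEcard sS'M minS //.
  by rewrite /Q sS'C ntS' (subset_trans sS'M).
have [z Sz ntz] : exists2 z, z \in S & nilres n h <<z ^: M>>%G != 1 :> {set gT}.
  apply/exists_inP; rewrite -[[exists _ in _, _]]negbK negb_exists_in.
  apply: contra ntS => /forall_inP triv; rewrite -subG1.
  apply: (@nilres_class_gen n h gT M 1%G S) => // [|s Ss]; first exact: leGn.
  by have:= triv s Ss; rewrite negbK => /eqP->.
have Mz : z \in M by rewrite mem_gen.
have sCMC : z ^: M \subset x ^: G.
  by rewrite -(class_eqP (subsetP sSC z Sz)) imsetS.
have defM : <<z ^: M>> = M by apply: minM; rewrite // gen_subG class_subG.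
have [||y [yC defY]] := @minimal_generators_fewP n h gT M z (leGn _ sMG) solM Mz defM.
- exact: ntS.
- move=> S' sS'C; apply: minM; first exact: subset_trans sCMC.
  by rewrite gen_subG (subset_trans sS'C) ?class_subG.
pose K := nilres n h M; pose Y := [set y i | i : 'I_7].
have sYC : Y \subset x ^: G.
  by apply/subsetP=> _ /imsetP[i _ ->]; apply: (subsetP sCMC).
have leY : #|Y| <= 7 by rewrite (leq_trans (leq_imset_card _ _)) // card_ord.
have [q q_pr q_dv] : exists2 q, prime q & q %| #|K|.
  by exists (pdiv #|K|); rewrite ?pdiv_dvd // pdiv_prime // cardG_gt1.
have [u Ku ou] := Cauchy q_pr q_dv.
have sKG : K \subset G := subset_trans (nilres_sub _ _ _) sMG.
have qu : q.-elt u by rewrite /p_elt ou pnat_id.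
(* For each [g], both [u] and [u ^ g] lie in the [h]-th residual of a group generated by 7 + 7
   conjugates. This residual is nilpotent by maximality of [h], so both lie in its q-core. *)
have Ou : u \in 'O_q(G).
  apply: Baer_Suzuki (subsetP sKG u Ku) _ => g Gg.
  pose U : {set gT} := Y :|: Y :^ g; pose L := <<U>>%G.
  have sLC : U \subset x ^: G.
    by rewrite subUset sYC /= -(normP (subsetP (class_norm x G) g Gg)) conjSg.
  have sLG : L \subset G by rewrite gen_subG (subset_trans sLC).
  have nilL : nilpotent (nilres n h L).
    apply: nilpotent_nilres; apply/eqP; rewrite -[_ == _]negbK; apply/negP=> ntL.
    have /maxh : P h.+1.
      apply/existsP; exists U; rewrite sLC ntL andbT /=.
      by rewrite (leq_trans (leq_card_setU _ _)) // cardJg (@leq_add _ _ 7 7).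
    by rewrite ltnn.
  have sML : M \subset L by rewrite -[gval M]defY genS // subsetUl.
  have sMgL : (M :^ g)%G \subset L.
    by rewrite /= -[gval M]defY -genJ genS // subsetUr.
  have sylO := nilpotent_pcore_Hall q nilL.
  have Lq v : v \in nilres n h L -> q.-elt v -> v \in 'O_q(nilres n h L).
    by move=> Lv; rewrite (mem_normal_Hall sylO) ?pcore_normal.
  apply: pgroupS (pcore_pgroup q (nilres n h L)).
  rewrite gen_subG subUset !sub1set !Lq ?p_eltJ //.
    by rewrite (subsetP (nilres_mono n h sMgL)) // nilresJ memJ_conjg.
  by rewrite (subsetP (nilres_mono n h sML)).
pose O := 'O_q(G)%G.
have nsOG : O <| G := pcore_normal _ _.
have [sOG nOG] := andP nsOG.
have ntO : O :!=: 1.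
  apply: contraTneq Ou => ->; rewrite inE -order_eq1 ou.
  by rewrite neq_ltn prime_gt1 // orbT.
have defCO : coset O x ^: (G / O) = coset O @: (x ^: G).
  rewrite -quotient_class ?(subsetP nOG) // /quotient morphimEsub //.
  exact: subset_trans nOG.
have nOC : <<x ^: G>> \subset 'N(O) by rewrite gen_subG (subset_trans sCG).
have solCO : solvable (<<x ^: G>> / O).
  have -> : <<x ^: G>> / O = <<coset O x ^: (G / O)>>.
    rewrite quotient_gen ?quotient_class ?(subsetP nOG) //.
    exact: subset_trans nOG.
  apply: IHm => [||Sq sSqC leSq].
  - by rewrite (leq_trans _ leGm) // ltn_quotient.
  - exact: mem_quotient.
  rewrite defCO in sSqC.
  (* Preimages are chosen inside the class; the value 1 outside [Sq] is a dummy. *)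
  have /fin_all_exists[f fP] s : exists r, s \in Sq -> r \in x ^: G /\ coset O r = s.
    have [/(subsetP sSqC)/imsetP[r Cr ->] | ] := boolP (s \in Sq); first by exists r.
    by exists 1.
  have sfC : f @: Sq \subset x ^: G.
    by apply/subsetP=> _ /imsetP[s /fP[Cfs _] ->].
  have -> : Sq = (f @: Sq) / O.
    rewrite /quotient morphimEsub ?(subset_trans sfC) ?(subset_trans sCG) //.
    rewrite -imset_comp -[LHS]imset_id; apply: eq_in_imset => s /fP[_] /= ->.
    by [].
  rewrite -quotient_gen ?(subset_trans sfC) ?(subset_trans sCG) //.
  by rewrite quotient_sol // solS // (leq_trans (leq_imset_card _ _)).
have nsOCO : O <| <<x ^: G>> <*> O by rewrite /normal joing_subr join_subG nOC normG.
apply: solvableS (joing_subl _ O) _; rewrite (series_sol nsOCO) quotientYidr //.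
by rewrite (pgroup_sol (pcore_pgroup _ _)) solCO.
Qed.

Theorem theorem1 :
  exists k : nat, (0 < k)%N /\
    forall (gT : finGroupType) (G : {group gT}) (C : {set gT}),
      C \in classes G ->
      (forall x : 'I_k -> gT, (forall i, x i \in C) ->
         solvable <<[set x i | i : 'I_k]>>) ->
      solvable <<C>>.
Proof.
exists 14; split=> // gT G _ /imsetP[x Gx ->] solC.
apply: class_gen_solvable => // S sSC leS.
have [->|[s Ss]] := set_0Vmem S; first by rewrite gen0 solvable1.
(* The enumeration of [S] is padded with its element [s] to length 14. *)
pose f (i : 'I_14) := nth s (enum S) i.
have Sf i : f i \in S.
  have [lti | gei] := ltnP i (size (enum S)); last by rewrite /f nth_default.
  by rewrite -mem_enum mem_nth.
have -> : S = [set f i | i : 'I_14].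
  apply/setP=> z; apply/idP/imsetP=> [Sz | [i _ ->] //].
  have ltz : index z (enum S) < 14.
    by apply: leq_trans leS; rewrite cardE index_mem mem_enum.
  by exists (Ordinal ltz); rewrite // /f /= nth_index ?mem_enum.
by apply: solC => i; apply: (subsetP sSC).
Qed.
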